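(* Let $H$ be an infinite-dimensional separable Hilbert space and let $(X,\mu)$ be a positive $\sigma$-finite measure space with $\mu(X)=\infty$. Let $F:X\to H$ be a phase retrieval continuous frame with frame bounds $A,B$, and suppose that for every measurable subset $Y\subseteq X$ with $\mu(Y)<\infty$ the restriction $F|_Y$ is not $\mu$-complete. Then for every $\epsilon$ with $0<\epsilon<A$ there exists $G:X\to H$ such that $G$ is not phase retrieval and $$\int_X\|F(x)-G(x)\|^2\,d\mu(x)<\epsilon.$$
   Context: A mapping $F:X\to H$ is weakly measurable if $x\mapsto\langle f,F(x)\rangle$ is measurable for every $f\in H$. A continuous frame for $H$ with respect to $(X,\mu)$ with frame bounds $A,B>0$ is a weakly measurable $F:X\to H$ with $A\|f\|^2\le\int_X|\langle f,F(x)\rangle|^2\,d\mu(x)\le B\|f\|^2$ for all $f\in H$. A Bessel mapping is a weakly measurable mapping for which the upper inequality holds for some $B>0$. A mapping $F:X\to H$ is phase retrieval if for all $f,g\in H$, the condition $|\langle f,F(x)\rangle|=|\langle g,F(x)\rangle|$ for $\mu$-almost all $x\in X$ implies $f=e^{i\theta}g$ for some $\theta\in\mathbb{R}$; it is not phase retrieval if this implication fails for some $f,g\in H$. A Bessel mapping $F:X\to H$ is $\mu$-complete if $\left\{\int_X\phi(x)F(x)\,d\mu(x) : \phi\in L^2(X,\mu)\right\}$ is dense in $H$, the integrals being understood in the weak sense. For a measurable $Y\subseteq X$, this is applied to $F|_Y$ with the restriction of $\mu$ to $Y$. *)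

(* Defs.v *)
From HB Require Import structures.
From mathcomp Require Import all_boot all_order all_algebra.
From mathcomp Require Import all_classical all_reals all_analysis.
From mathcomp Require Export sesquilinear complex.

Set Implicit Arguments.
Unset Strict Implicit.
Unset Printing Implicit Defensive.

Import Order.TTheory GRing.Theory Num.Theory.
Import numFieldNormedType.Exports.

Local Open Scope classical_set_scope.
Local Open Scope ring_scope.

(* The norm of a normed space over R[i] takes its values in R[i], inside the
   nonnegative reals; [rnorm] is the same number seen in R. *)
Definition rnorm (R : realType) (V : normedZmodType R[i]) (v : V) : R :=
  complex.Re `|v|.

(* The norm of the Banach space H is induced by the inner product [dotp]
   (linear in its first argument, conjugate-linear in the second), so that
   H is a complex Hilbert space. *)
Definition hilbert_norm (R : realType) (H : completeNormedModType R[i])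
    (dotp : {dot H for @Num.conj R[i]}) : Prop :=
  forall f : H, `|f| ^+ 2 = dotp f f.

Definition infinite_dimensional (K : numFieldType) (V : normedModType K) : Prop :=
  ~ exists (n : nat) (e : 'I_n -> V),
      forall v : V, exists c : 'I_n -> K, v = \sum_(i < n) c i *: e i.

Definition separable (T : topologicalType) : Prop :=
  exists2 S : set T, countable S & dense S.

Definition expi (R : realType) (theta : R) : R[i] :=
  Complex (cos theta) (sin theta).

Section ComplexFunctions.
Context {d : measure_display} {X : measurableType d} {R : realType}.

Definition cmeasurable_fun (D : set X) (u : X -> R[i]) : Prop :=
  measurable_fun D (fun x => complex.Re (u x)) /\
  measurable_fun D (fun x => complex.Im (u x)).

Variable mu : {measure set X -> \bar R}.

Definition cintegrable (D : set X) (u : X -> R[i]) : Prop :=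
  mu.-integrable D (fun x => (complex.Re (u x))%:E) /\
  mu.-integrable D (fun x => (complex.Im (u x))%:E).

Definition cintegral (D : set X) (u : X -> R[i]) : R[i] :=
  Complex (\int[mu]_(x in D) complex.Re (u x))
          (\int[mu]_(x in D) complex.Im (u x)).

Definition square_integrable (D : set X) (phi : X -> R[i]) : Prop :=
  cmeasurable_fun D phi /\
  (\int[mu]_(x in D) (rnorm (phi x) ^+ 2)%:E < +oo)%E.

End ComplexFunctions.

Section Frames.
Context {d : measure_display} {X : measurableType d} {R : realType}.
Context {H : completeNormedModType R[i]}.
Variable dotp : {dot H for @Num.conj R[i]}.

Definition weakly_measurable (F : X -> H) : Prop :=
  forall f : H, cmeasurable_fun setT (fun x => dotp f (F x)).

Variable mu : {measure set X -> \bar R}.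

Definition continuous_frame (F : X -> H) (A B : R) : Prop :=
  [/\ 0 < A, 0 < B, weakly_measurable F &
    forall f : H,
      ((A * rnorm f ^+ 2)%:E
         <= \int[mu]_x (rnorm (dotp f (F x)) ^+ 2)%:E
         <= (B * rnorm f ^+ 2)%:E)%E].

Definition phase_retrieval (F : X -> H) : Prop :=
  forall f g : H,
    {ae mu, forall x, `|dotp f (F x)| = `|dotp g (F x)|} ->
    exists theta : R, f = expi theta *: g.

(* h = \int_D phi F dmu in the weak sense. *)
Definition weak_integral (D : set X) (phi : X -> R[i]) (F : X -> H) (h : H)
    : Prop :=
  forall f : H,
    cintegrable mu D (fun x => phi x * dotp (F x) f) /\
    dotp h f = cintegral mu D (fun x => phi x * dotp (F x) f).

(* mu-completeness of the restriction of F to the measurable set D, with the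
   restriction of mu to D; the notion is meant for Bessel mappings, for which
   the weak integral exists for every square-integrable phi. *)
Definition mu_complete (D : set X) (F : X -> H) : Prop :=
  dense [set h : H | exists phi : X -> R[i],
    square_integrable mu D phi /\ weak_integral D phi F h].

End Frames.

(* Main.v *)
Require Import Defs.
From HB Require Import structures.
From mathcomp Require Import all_boot all_order all_algebra.
From mathcomp Require Import all_classical all_reals all_analysis.
From mathcomp Require Import measurable_realfun ring lra.

(** Phase retrieval forces a kind of complement property: if X splits into two
    pieces such that a.e. on the first piece F(x) is orthogonal to h, and
    a.e. on the second it is orthogonal to f, then f + h and f - h have
    measurements of the same modulus, although they do not differ by a phase
    as soon as f and h are independent
    ([not_phase_retrieval_of_complementary]).  The proof perturbs F, at a cost
    less than eps, into a mapping that has such a pair.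

    Let f be a unit vector.  The frame inequality makes |<f, F(x)>|^2
    integrable, and mu is sigma-finite, so some Y of finite measure satisfies
    int_{X \ Y} |<f, F>|^2 < eps ([integral_tail_lt]).  Off Y, replace F(x) by its
    projection onto the orthogonal complement of f ([project_off]); the square
    distance to F is exactly that tail integral.  On Y nothing changes.  There,
    the failure of completeness yields h != 0 with <h, F(x)> = 0 for almost
    every x in Y ([orthogonal_of_not_mu_complete]).  Finally h cannot be a
    multiple of f: otherwise <f, F> would vanish a.e. on Y, and the lower frame
    bound would give A <= int_{X \ Y} |<f, F>|^2 < eps < A.

    To obtain h, let T g be the weak integral int_Y <g, F> F dmu, which
    exists by the Riesz representation theorem ([riesz]).  The range of T is a
    linear subspace of the set of weak integrals over Y, hence it is not dense,
    and some w != 0 is orthogonal to it ([orthogonal_of_not_dense]).  Then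
    0 = <T w, w> = int_Y |<w, F>|^2.  Both facts from Hilbert space theory come
    from one minimization argument, [minimal_vector]. *)

Set Implicit Arguments.
Unset Strict Implicit.
Unset Printing Implicit Defensive.

Import Order.TTheory GRing.Theory Num.Theory.
Import numFieldNormedType.Exports.

Local Open Scope classical_set_scope.
Local Open Scope ring_scope.

(** * The real-valued norm *)

Section RealNorm.
Context {R : realType}.

Section Vectors.
Context {V : normedZmodType R[i]}.

Lemma rnormE (v : V) : (rnorm v)%:C%C = `|v|.
Proof. by rewrite RRe_real// normr_real. Qed.

Lemma rnorm_ge0 (v : V) : 0 <= rnorm v.
Proof. by rewrite -ler0c rnormE. Qed.

Lemma rnorm_gt0 (v : V) : (0 < rnorm v) = (v != 0).
Proof. by rewrite -normr_gt0 -rnormE -ltcR. Qed.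

Lemma rnormD (u v : V) : rnorm (u + v) <= rnorm u + rnorm v.
Proof. by rewrite -lecR rmorphD /= !rnormE ler_normD. Qed.

Lemma rnormBC (u v : V) : rnorm (u - v) = rnorm (v - u).
Proof. by rewrite /rnorm distrC. Qed.

End Vectors.

Lemma rnormZ (a : R[i]) {V : normedModType R[i]} (v : V) :
  rnorm (a *: v) = rnorm a * rnorm v.
Proof. by apply: complexI; rewrite rnormE normrZ rmorphM /= !rnormE. Qed.

Lemma rnormM (z w : R[i]) : rnorm (z * w) = rnorm z * rnorm w.
Proof. by apply: complexI; rewrite rmorphM /= !rnormE normrM. Qed.

Lemma sqr_rnorm (z : R[i]) :
  rnorm z ^+ 2 = complex.Re z ^+ 2 + complex.Im z ^+ 2.
Proof. by apply: complexI; rewrite add_Re2_Im2 rmorphXn /= rnormE. Qed.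

End RealNorm.

(** * Hilbert space geometry *)

Section HilbertSpace.
Context {R : realType} {H : completeNormedModType R[i]}.
Context (dotp : {dot H for @Num.conj R[i]}) (H_hilbert : hilbert_norm dotp).

Lemma dotpC (u v : H) : dotp u v = (dotp v u)^*.
Proof. by rewrite hermC expr0 mul1r. Qed.

Lemma dotpZl (a : R[i]) (u v : H) : dotp (a *: u) v = a * dotp u v.
Proof. exact: linearZl_LR. Qed.

Lemma dotpZr (a : R[i]) (u v : H) : dotp u (a *: v) = a^* * dotp u v.
Proof. exact: linearZr_LR. Qed.

Lemma dotpDl (u v w : H) : dotp (u + v) w = dotp u w + dotp v w.
Proof. exact: linearDl. Qed.

Lemma dotpBl (u v w : H) : dotp (u - v) w = dotp u w - dotp v w.
Proof. exact: linearBl. Qed.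

Lemma dotpDr (u v w : H) : dotp u (v + w) = dotp u v + dotp u w.
Proof. exact: linearDr. Qed.

Lemma dotpNr (u v : H) : dotp u (- v) = - dotp u v.
Proof. exact: linearNr. Qed.

Lemma dotp_rnorm (v : H) : dotp v v = (rnorm v ^+ 2)%:C%C.
Proof. by rewrite -H_hilbert rmorphXn /= rnormE. Qed.

Lemma sqr_rnormD (u v : H) :
  rnorm (u + v) ^+ 2
  = rnorm u ^+ 2 + rnorm v ^+ 2 + complex.Re (dotp u v) *+ 2.
Proof.
have h x : rnorm x ^+ 2 = complex.Re (dotp x x) by rewrite dotp_rnorm.
rewrite !h dnormD -/(dotp v u).
case: (dotp u u) (dotp v v) (dotp u v) => [a b] [c e] [p q] /=; ring.
Qed.

Lemma parallelogram (u v : H) :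
  rnorm (u + v) ^+ 2 + rnorm (u - v) ^+ 2 = 2 * (rnorm u ^+ 2 + rnorm v ^+ 2).
Proof.
rewrite !sqr_rnormD dotpNr /rnorm normrN -/(rnorm v) -/(rnorm u).
case: (dotp u v) => p q /=; ring.
Qed.

(** Moving w along s by the best multiple decreases the square norm by
    |<w, s>|^2 / |s|^2. *)
Lemma rnorm_min_orthogonal (w s : H) :
  (forall t : R[i], rnorm w <= rnorm (w + t *: s)) -> dotp w s = 0.
Proof.
move=> wmin; have [->|s0] := eqVneq s 0; first by rewrite linear0r.
have n0 : 0 < rnorm s ^+ 2 by rewrite exprn_gt0 // rnorm_gt0.
(* This multiple minimizes the norm: w + t s is then orthogonal to s. *)
have := wmin ((- (rnorm s ^+ 2)^-1)%:C%C * dotp w s).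
rewrite -ler_sqr ?nnegrE ?rnorm_ge0 // sqr_rnormD dotpZr rnormZ exprMn !sqr_rnorm.
case: (dotp w s) => p q /=; rewrite !(mul0r, mulr0, subr0, addr0, add0r) /=.
set n := rnorm s ^+ 2 in n0 *.
rewrite -addrA lerDl => le0.
have pq0 : p ^+ 2 + q ^+ 2 <= 0.
  rewrite -(pmulr_rle0 _ (_ : 0 < n^-1)) ?invr_gt0 // -oppr_ge0.
  apply: le_trans le0 _; rewrite le_eqVlt; apply/orP; left; apply/eqP.
  by rewrite mulr2n; field; rewrite gt_eqF.
move: pq0; rewrite le_eqVlt ltNge addr_ge0 ?sqr_ge0 // orbF.
by rewrite paddr_eq0 ?sqr_ge0 // !sqrf_eq0 => /andP[/eqP-> /eqP->].
Qed.

(** Completeness of H, with real tolerances in place of the positive elements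
    of R[i] by which the uniform structure of H is indexed. *)
Lemma rnorm_complete (u : nat -> H) :
  (forall e : R, 0 < e ->
    exists N, forall m n, (N <= m)%N -> (N <= n)%N -> rnorm (u m - u n) < e) ->
  exists w, forall e : R, 0 < e ->
    exists N, forall n, (N <= n)%N -> rnorm (w - u n) < e.
Proof.
move=> u_cauchy.
have /cauchy_cvg/cvg_ballP w_lim : cauchy (u n @[n --> \oo]).
  apply: cauchy_exP => e e0.
  have eE : e = (complex.Re e)%:C%C by rewrite RRe_real // gtr0_real.
  have [N uN] : exists N, forall m n, (N <= m)%N -> (N <= n)%N ->
      rnorm (u m - u n) < complex.Re e.
    by apply: u_cauchy; rewrite -ltcR -eE.
  exists (u N), N => // n /= Nn.
  by rewrite -ball_normE /= eE -rnormE ltcR uN.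
exists (lim (u n @[n --> \oo])) => e e0.
have [|N _ uN] := w_lim e%:C%C; first by rewrite ltcR.
by exists N => n Nn; have := uN n Nn; rewrite /= -ball_normE /= -rnormE ltcR.
Qed.

(** The element of least norm of the closure of C: by the parallelogram law
    and the stability of C under midpoints, a minimizing sequence is Cauchy,
    and its limit w cannot be shortened along a direction that preserves C.
    As C may fail to be closed, w is only known to be a limit of points of C.
    This serves both for C a hyperplane, in [riesz], and for C a translate of
    a subspace, in [orthogonal_of_not_dense]. *)
Lemma minimal_vector (C S : set H) : C !=set0 ->
  (forall x y, C x -> C y -> C (2^-1 *: (x + y))) ->
  (forall x s (t : R[i]), C x -> S s -> C (x + t *: s)) ->
  exists w, (forall e : R, 0 < e -> exists2 c, C c & rnorm (w - c) < e) /\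
    (forall s, S s -> dotp w s = 0).
Proof.
move=> [c0 Cc0] Cmid CS.
pose N2 := [set rnorm c ^+ 2 | c in C].
have N2lb : has_lbound N2 by exists 0 => _ [c _ <-]; rewrite sqr_ge0.
have N2inf : has_inf N2 by split => //; exists (rnorm c0 ^+ 2), c0.
pose m := inf N2.
have m_le c : C c -> m <= rnorm c ^+ 2 by move=> Cc; apply: ge_inf => //; exists c.
have /choice[u uP] : forall n, exists c, C c /\ rnorm c ^+ 2 < m + n.+1%:R^-1.
  move=> n; have [||_ [c Cc <-] lt_c] := @inf_adherent _ N2 n.+1%:R^-1 => //.
  by exists c.
have small (e : R) : 0 < e -> exists N, forall n, (N <= n)%N -> n.+1%:R^-1 < e.
  move=> e0; have [N _ NP] := near_infty_natSinv_lt (PosNum e0).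
  by exists N => n Nn; exact: NP.
have uB i j : rnorm (u i - u j) ^+ 2 <= 2 * (i.+1%:R^-1 + j.+1%:R^-1).
  have [Ci ui] := uP i; have [Cj uj] := uP j.
  have := m_le _ (Cmid _ _ Ci Cj); rewrite rnormZ exprMn.
  have -> : rnorm (2^-1 : R[i]) ^+ 2 = 4^-1.
    apply: complexI.
    by rewrite rmorphXn /= rnormE fmorphV /= rmorph_nat normfV normr_nat exprVn -natrX.
  have := parallelogram (u i) (u j); move: ui uj.
  move: (rnorm (u i + u j) ^+ 2) (rnorm (u i - u j) ^+ 2) (rnorm (u i) ^+ 2).
  move: (rnorm (u j) ^+ 2) (i.+1%:R^-1) (j.+1%:R^-1) => *.
  lra.
have [|w uw] := @rnorm_complete u.
  move=> e e0; have [|N NP] := small (e ^+ 2 / 4); first by rewrite divr_gt0 // exprn_gt0.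
  exists N => i j /NP Hi /NP Hj.
  rewrite -ltr_sqr ?nnegrE ?rnorm_ge0 ?ltW //.
  apply: le_lt_trans (uB i j) _.
  by move: (i.+1%:R^-1) (j.+1%:R^-1) Hi Hj => a b; lra.
exists w; split.
  move=> e /uw[N wN]; exists (u N); last exact: wN.
  by have [] := uP N.
have w_min c : C c -> rnorm w <= rnorm c.
  move=> Cc; rewrite leNgt; apply/negP => lt_cw.
  pose e := (rnorm w - rnorm c) / 2.
  have e0 : 0 < e by rewrite /e; lra.
  have [N wN] := uw e e0; have [|M eM] := small (e ^+ 2); first by rewrite exprn_gt0.
  have := wN (maxn N M) (leq_maxl _ _); have := eM (maxn N M) (leq_maxr _ _).
  have [_] := uP (maxn N M); set v := u (maxn N M).
  have := rnormD (w - v) v; rewrite subrK.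
  have := m_le _ Cc; have := rnorm_ge0 c.
  set r := _.+1%:R^-1.
  rewrite /e in e0 *; move: (rnorm (w - v)) (rnorm w) (rnorm v) (rnorm c) e0 => a b c' d.
  nra.
move=> s Ss; apply: rnorm_min_orthogonal => t; apply/ler_addgt0Pl => e /uw[N wN].
have [CN _] := uP N.
apply: le_trans (w_min _ (CS _ _ t CN Ss)) _.
have -> : u N + t *: s = (u N - w) + (w + t *: s) by rewrite addrA subrK.
by apply: le_trans (rnormD _ _) _; rewrite lerD2r rnormBC ltW // wN.
Qed.

(** The hyperplane phi = 1 has an element of least norm, which is orthogonal to
    the kernel of phi; every f differs from a multiple of it by an element of
    the kernel.  Boundedness on the unit sphere ensures that the limit given by
    [minimal_vector] still lies in the hyperplane. *)
Lemma riesz (phi : H -> R[i]) (M : R) :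
  (forall a u v, phi (a *: u + v) = a * phi u + phi v) ->
  (forall f, rnorm f = 1 -> rnorm (phi f) <= M) ->
  exists v, forall f, phi f = dotp f v.
Proof.
move=> phi_lin phi_unit.
have phi0 : phi 0 = 0.
  by have := phi_lin (-1) 0 0; rewrite scaler0 addr0 mulN1r addNr.
have phiZ a u : phi (a *: u) = a * phi u.
  by have := phi_lin a u 0; rewrite phi0 !addr0.
have phi_bnd f : rnorm (phi f) <= M * rnorm f.
  have [->|f0] := eqVneq f 0; first by rewrite phi0 /rnorm !normr0 mulr0.
  have nf0 : 0 < rnorm f by rewrite rnorm_gt0.
  have nfC0 : (rnorm f)%:C%C != 0 by rewrite rnormE normr_eq0.
  have rnormf : rnorm (rnorm f)%:C%C = rnorm f.
    by apply: complexI; rewrite 2!rnormE normr_id.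
  pose e := (rnorm f)%:C%C^-1 *: f.
  have fE : f = (rnorm f)%:C%C *: e by rewrite scalerA mulfV // scale1r.
  have e1 : rnorm e = 1.
    apply: (mulfI (lt0r_neq0 nf0)).
    by rewrite mulr1 -[X in X * _]rnormf -rnormZ -fE.
  rewrite {1}fE phiZ rnormM rnormf mulrC ler_wpM2r ?rnorm_ge0 //.
  exact: phi_unit.
have phiD u v : phi (u + v) = phi u + phi v.
  by have := phi_lin 1 u v; rewrite scale1r mul1r.
have [phi_eq0|/existsNP[u /eqP phiu]] := pselect (forall f, phi f = 0).
  by exists 0 => f; rewrite phi_eq0 -[0 in RHS](scale0r (0 : H)) dotpZr rmorph0 mul0r.
have [|x y Cx Cy|x s t Cx Ss|w [w_lim w_perp]] :=
    @minimal_vector [set f | phi f = 1] [set f | phi f = 0].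
- by exists ((phi u)^-1 *: u); rewrite /= phiZ mulVf.
- by rewrite /= phiZ phiD Cx Cy mulVf // pnatr_eq0.
- by rewrite /= phiD phiZ Ss mulr0 addr0.
(* w is a limit of points where phi = 1; adding 1 keeps the bound positive. *)
have phiw : phi w = 1.
  apply/eqP; rewrite -subr_eq0; apply: contraT; rewrite -rnorm_gt0 => d0.
  have M0 : 0 < `|M| + 1 by rewrite ltr_wpDl.
  have [|c Cc wc] := w_lim (rnorm (phi w - 1) / (`|M| + 1)); first exact: divr_gt0.
  have := phi_bnd (w - c).
  rewrite -scaleN1r phiD phiZ Cc mulr1.
  have := ler_norm M; have := rnorm_ge0 (w - c).
  move: wc; rewrite ltr_pdivlMr // scaleN1r.
  move: (rnorm (w - c)) (rnorm (phi w - 1)) => a b.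
  nra.
have w0 : dotp w w != 0.
  rewrite dotp_rnorm -(rmorph0 (real_complex R)) (inj_eq (@complexI R)).
  rewrite gt_eqF // exprn_gt0 // rnorm_gt0; apply: contra_eq_neq phiw => ->.
  by rewrite phi0 eq_sym oner_eq0.
exists ((dotp w w)^-1 *: w) => f.
have := w_perp (f - phi f *: w).
rewrite /= -scaleN1r phiD !phiZ phiw mulr1 mulN1r subrr => /(_ erefl).
rewrite scaleN1r dotpC dotpBl dotpZl => /eqP.
rewrite conjC_eq0 subr_eq0 => /eqP fw.
by rewrite dotpZr fmorphV /= -dotpC fw mulrCA mulVf ?mulr1.
Qed.

(** The orthogonality half of the projection theorem: if h0 is at positive
    distance from the subspace S, the shortest vector in the closure of h0 + S
    is nonzero and orthogonal to S. *)
Lemma orthogonal_of_not_dense (S : set H) : S !=set0 ->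
  (forall (t : R[i]) x y, S x -> S y -> S (x + t *: y)) -> ~ dense S ->
  exists2 w, w != 0 & forall s, S s -> dotp w s = 0.
Proof.
move=> [s0 Ss0] S_lin; rewrite /dense => /existsNP[U].
move=> /not_implyP[[h0 Uh0] /not_implyP[U_open US]].
have [r r0 hr] : exists2 r : R, (0 < r) & forall h, rnorm (h0 - h) < r -> U h.
  have [r /= r0 rU] : exists2 r : R[i], (0 < r) & ball h0 r `<=` U.
    by apply/nbhs_ballP; apply: open_nbhs_nbhs; split.
  have rE : r = (complex.Re r)%:C%C by rewrite RRe_real // gtr0_real.
  exists (complex.Re r); first by rewrite -ltcR -rE.
  by move=> h hr; apply: rU; rewrite -ball_normE /= -rnormE rE ltcR.
have S0 : S 0 by have := S_lin (-1) _ _ Ss0 Ss0; rewrite scaleN1r subrr.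
have SZ t x : S x -> S (t *: x) by move=> Sx; have := S_lin t _ _ S0 Sx; rewrite add0r.
have SD x y : S x -> S y -> S (x + y).
  by move=> Sx Sy; have := S_lin 1 _ _ Sx Sy; rewrite scale1r.
have [|x y Cx Cy|x s t Cx Ss|w [w_lim w_perp]] :=
    @minimal_vector [set h0 + s | s in S] S.
- by exists (h0 + 0), 0.
- case: Cx Cy => [a Sa <-] [b Sb <-]; exists (2^-1 *: (a + b)); first exact/SZ/SD.
  have half2 : 2^-1 + 2^-1 = 1 :> R[i] by rewrite -[2^-1]mul1r -splitr.
  by rewrite addrACA [RHS]scalerDr [2^-1 *: (h0 + h0)]scalerDr -scalerDl half2 scale1r.
- by case: Cx => [a Sa <-]; exists (a + t *: s); [exact/SD/SZ|rewrite addrA].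
exists w => //; apply/eqP => w0; apply: US.
have [_ [s Ss <-]] := w_lim r r0.
rewrite w0 sub0r opprD => sr; exists (- s); split; last by rewrite -scaleN1r; exact: SZ.
by apply: hr; rewrite opprK /rnorm -normrN opprD.
Qed.

End HilbertSpace.

(** * Integrals of products of complex functions *)

Section ComplexIntegration.
Context {d : measure_display} {X : measurableType d} {R : realType}.
Context (mu : {measure set X -> \bar R}).
Implicit Types (D : set X) (u v : X -> R[i]).

Lemma ReM (z w : R[i]) : complex.Re (z * w)
  = complex.Re z * complex.Re w - complex.Im z * complex.Im w.
Proof. by case: z w => [a b] [c e]. Qed.

Lemma ImM (z w : R[i]) : complex.Im (z * w)
  = complex.Re z * complex.Im w + complex.Im z * complex.Re w.
Proof. by case: z w => [a b] [c e]. Qed.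

Lemma ReConj (z : R[i]) : complex.Re z^* = complex.Re z.
Proof. by case: z. Qed.

Lemma ImConj (z : R[i]) : complex.Im z^* = - complex.Im z.
Proof. by case: z. Qed.

Lemma cmeasurable_conj D u :
  cmeasurable_fun D u -> cmeasurable_fun D (fun x => (u x)^*).
Proof.
move=> [mr mi]; split.
  rewrite (_ : (fun _ => _) = fun x => complex.Re (u x)) //.
  by apply/funext => x; rewrite ReConj.
rewrite (_ : (fun _ => _) = fun x => - complex.Im (u x)).
  exact: measurable_funN.
by apply/funext => x; rewrite ImConj.
Qed.

Lemma cmeasurable_funM D u v : cmeasurable_fun D u -> cmeasurable_fun D v ->
  cmeasurable_fun D (fun x => u x * v x).
Proof.
move=> [ur ui] [vr vi]; split.
  under [X in measurable_fun _ X]eq_fun do rewrite ReM.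
  by apply: measurable_funB; apply: measurable_funM.
under [X in measurable_fun _ X]eq_fun do rewrite ImM.
by apply: measurable_funD; apply: measurable_funM.
Qed.

Lemma cmeasurable_funD D u v : cmeasurable_fun D u -> cmeasurable_fun D v ->
  cmeasurable_fun D (fun x => u x + v x).
Proof.
have ReD (z w : R[i]) : complex.Re (z + w) = complex.Re z + complex.Re w.
  by case: z w => [? ?] [].
have ImD (z w : R[i]) : complex.Im (z + w) = complex.Im z + complex.Im w.
  by case: z w => [? ?] [].
move=> [ur ui] [vr vi]; split.
  by under [X in measurable_fun _ X]eq_fun do rewrite ReD; exact: measurable_funD.
by under [X in measurable_fun _ X]eq_fun do rewrite ImD; exact: measurable_funD.
Qed.

Lemma cmeasurable_sqr_rnorm D u : cmeasurable_fun D u ->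
  measurable_fun D (fun x => rnorm (u x) ^+ 2).
Proof.
move=> [ur ui]; under [X in measurable_fun _ X]eq_fun do rewrite sqr_rnorm.
by apply: measurable_funD; apply: measurable_funX.
Qed.

Lemma cintegral_linear D (a : R[i]) u v : measurable D ->
  cintegrable mu D u -> cintegrable mu D v ->
  cintegral mu D (fun x => a * u x + v x)
  = a * cintegral mu D u + cintegral mu D v.
Proof.
move=> mD [ur ui] [vr vi].
have IZ (r : R) (f : X -> R) : mu.-integrable D (EFin \o f) ->
  mu.-integrable D (EFin \o (fun x => r * f x)) by exact: integrableZl.
have ID (f g : X -> R) : mu.-integrable D (EFin \o f) ->
  mu.-integrable D (EFin \o g) -> mu.-integrable D (EFin \o (fun x => f x + g x)).
  exact: integrableD.
have IN (f g : X -> R) : mu.-integrable D (EFin \o f) ->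
  mu.-integrable D (EFin \o g) -> mu.-integrable D (EFin \o (fun x => f x - g x)).
  exact: integrableB.
apply/eqP; rewrite eq_complex; case: a => p q /=; apply/andP; split; apply/eqP.
  rewrite -[in RHS]RintegralZl // -[in X in _ = _ - X + _]RintegralZl //.
  rewrite -RintegralB //; [|exact: IZ..].
  rewrite -RintegralD //; [|apply: IN; exact: IZ].
  by apply: eq_Rintegral => x _; case: (u x) (v x) => [a b] [c e].
rewrite -[in RHS]RintegralZl // -[in X in _ = _ + X + _]RintegralZl //.
rewrite -RintegralD //; [|exact: IZ..].
rewrite -RintegralD //; [|apply: ID; exact: IZ].
by apply: eq_Rintegral => x _; case: (u x) (v x) => [a b] [c e].
Qed.

Lemma cintegral_conj D u : measurable D -> cintegrable mu D u ->
  cintegral mu D (fun x => (u x)^*) = (cintegral mu D u)^*.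
Proof.
move=> mD [ur ui]; apply/eqP; rewrite eq_complex /=; apply/andP; split; apply/eqP.
  by apply: eq_Rintegral => x _; rewrite ReConj.
rewrite -mulN1r -RintegralZl //.
by apply: eq_Rintegral => x _; rewrite ImConj mulN1r.
Qed.

Lemma square_integrableP D u : square_integrable mu D u ->
  mu.-integrable D (fun x => (rnorm (u x) ^+ 2)%:E).
Proof.
move=> [mu_u fin]; apply/integrableP; split.
  exact/measurable_EFinP/cmeasurable_sqr_rnorm.
apply: le_lt_trans fin.
under eq_integral do rewrite gee0_abs ?lee_fin ?sqr_ge0 //.
exact: lexx.
Qed.

Lemma normr_ReM_le (z w : R[i]) :
  `|complex.Re (z * w)| <= rnorm z ^+ 2 + rnorm w ^+ 2.
Proof.
rewrite !sqr_rnorm ReM; move: z w => [a b] [c e] /=.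
have := (sqr_ge0 (a + c), sqr_ge0 (a - c), sqr_ge0 (b + e), sqr_ge0 (b - e)).
rewrite !sqrrD !sqrrN => -[[[? ?] ?] ?]; rewrite ler_norml; apply/andP; split; nra.
Qed.

Lemma normr_ImM_le (z w : R[i]) :
  `|complex.Im (z * w)| <= rnorm z ^+ 2 + rnorm w ^+ 2.
Proof.
rewrite !sqr_rnorm ImM; move: z w => [a b] [c e] /=.
have := (sqr_ge0 (a + e), sqr_ge0 (a - e), sqr_ge0 (b + c), sqr_ge0 (b - c)).
rewrite !sqrrD !sqrrN => -[[[? ?] ?] ?]; rewrite ler_norml; apply/andP; split; nra.
Qed.

(** The real and imaginary parts of a product u v are both dominated by
    |u|^2 + |v|^2; this lemma and the next treat the two at once. *)
Lemma integrable_le_sqr_rnorm D u v (f : X -> R) : measurable D ->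
  square_integrable mu D u -> square_integrable mu D v ->
  measurable_fun D f ->
  (forall x, `|f x| <= rnorm (u x) ^+ 2 + rnorm (v x) ^+ 2) ->
  mu.-integrable D (fun x => (f x)%:E).
Proof.
move=> mD /square_integrableP iu /square_integrableP iv mf f_le.
apply: le_integrable (integrableD mD iu iv) => //; first exact/measurable_EFinP.
by move=> x _ /=; rewrite lee_fin (le_trans (f_le x)) // ler_norm.
Qed.

Lemma normr_Rintegral_le D u v (f : X -> R) (p q : R) : measurable D ->
  square_integrable mu D u -> square_integrable mu D v ->
  measurable_fun D f ->
  (forall x, `|f x| <= rnorm (u x) ^+ 2 + rnorm (v x) ^+ 2) ->
  (\int[mu]_(x in D) (rnorm (u x) ^+ 2)%:E <= p%:E)%E ->
  (\int[mu]_(x in D) (rnorm (v x) ^+ 2)%:E <= q%:E)%E ->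
  `|\int[mu]_(x in D) f x| <= p + q.
Proof.
move=> mD su sv mf f_le up vq.
have fi := integrable_le_sqr_rnorm mD su sv mf f_le.
have iu := square_integrableP su; have iv := square_integrableP sv.
apply: le_trans (le_normr_Rintegral mD fi) _.
rewrite -lee_fin fineK; last exact/integrable_fin_num/integrable_norm.
apply: le_trans (_ : (\int[mu]_(x in D)
    ((rnorm (u x) ^+ 2)%:E + (rnorm (v x) ^+ 2)%:E) <= _)%E).
  apply: ge0_le_integral => //.
  - exact/measurable_EFinP/measurableT_comp.
  - apply: emeasurable_funD; first exact: measurable_int iu.
    exact: measurable_int iv.
  - by move=> x _; rewrite -EFinD lee_fin.
by rewrite integralD //= EFinD leeD.
Qed.

Lemma cintegrableM D u v : measurable D ->
  square_integrable mu D u -> square_integrable mu D v ->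
  cintegrable mu D (fun x => u x * v x).
Proof.
move=> mD su sv; have [mr mi] := cmeasurable_funM su.1 sv.1.
split; apply: (integrable_le_sqr_rnorm mD su sv) => // x.
  exact: normr_ReM_le.
exact: normr_ImM_le.
Qed.

Lemma rnorm_cintegralM_le D u v (p q : R) : measurable D ->
  square_integrable mu D u -> square_integrable mu D v ->
  (\int[mu]_(x in D) (rnorm (u x) ^+ 2)%:E <= p%:E)%E ->
  (\int[mu]_(x in D) (rnorm (v x) ^+ 2)%:E <= q%:E)%E ->
  rnorm (cintegral mu D (fun x => u x * v x)) <= 2 * (p + q).
Proof.
move=> mD su sv up vq; have [mr mi] := cmeasurable_funM su.1 sv.1.
have re := normr_Rintegral_le mD su sv mr (fun x => normr_ReM_le _ _) up vq.
have im := normr_Rintegral_le mD su sv mi (fun x => normr_ImM_le _ _) up vq.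
have pq0 : 0 <= p + q by apply: le_trans re.
rewrite -ler_sqr ?nnegrE ?rnorm_ge0 ?mulr_ge0 // sqr_rnorm /=.
move: re im; rewrite !ler_norml => /andP[? ?] /andP[? ?]; nra.
Qed.

End ComplexIntegration.

(** * Restriction of a frame to a non-complete piece *)

Section Frames.
Context {d : measure_display} {X : measurableType d} {R : realType}.
Context {H : completeNormedModType R[i]}.
Context (dotp : {dot H for @Num.conj R[i]}) (H_hilbert : hilbert_norm dotp).
Context (mu : {measure set X -> \bar R}).

Lemma analysis_square_integrable (F : X -> H) (B : R) (Y : set X) (f : H) :
  measurable Y -> weakly_measurable dotp F ->
  (\int[mu]_x (rnorm (dotp f (F x)) ^+ 2)%:E <= B%:E)%E ->
  (\int[mu]_(x in Y) (rnorm (dotp f (F x)) ^+ 2)%:E <= B%:E)%E /\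
  square_integrable mu Y (fun x => dotp f (F x)).
Proof.
move=> mY mF F_le.
have le_Y : (\int[mu]_(x in Y) (rnorm (dotp f (F x)) ^+ 2)%:E <= B%:E)%E.
  apply: le_trans F_le; apply: ge0_subset_integral => //.
    exact/measurable_EFinP/cmeasurable_sqr_rnorm.
  by move=> x _; rewrite lee_fin sqr_ge0.
split=> //; split; last exact: le_lt_trans le_Y (ltry _).
by have [mr mi] := mF f; split; apply: measurable_funTS.
Qed.

(** The operator T g = int_Y <g, F> F dmu is self-adjoint, and its range
    consists of weak integrals with square-integrable coefficient <g, F>.  When
    Y is not complete, this range is thus not dense, and a vector w orthogonal
    to it satisfies int_Y |<w, F>|^2 = <T w, w> = 0. *)
Lemma orthogonal_of_not_mu_complete (F : X -> H) (B : R) (Y : set X) :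
  measurable Y -> weakly_measurable dotp F ->
  (forall f : H,
    (\int[mu]_x (rnorm (dotp f (F x)) ^+ 2)%:E <= (B * rnorm f ^+ 2)%:E)%E) ->
  ~ mu_complete dotp mu Y F ->
  exists2 h : H, h != 0 & {ae mu, forall x, Y x -> dotp h (F x) = 0}.
Proof.
move=> mY mF F_le F_ncomplete.
have sqF f := analysis_square_integrable mY mF (F_le f).
have sqFc f : (\int[mu]_(x in Y) (rnorm (dotp (F x) f) ^+ 2)%:E
      <= (B * rnorm f ^+ 2)%:E)%E /\
    square_integrable mu Y (fun x => dotp (F x) f).
  have -> : (fun x => dotp (F x) f) = (fun x => (dotp f (F x))^*).
    by apply/funext => x; rewrite dotpC.
  have rnormC x : rnorm (dotp f (F x))^* = rnorm (dotp f (F x)).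
    by rewrite /rnorm norm_conjC.
  have [fY [fm fi]] := sqF f.
  split; first by under eq_integral do rewrite dotpC rnormC.
  split; first exact: cmeasurable_conj.
  by under eq_integral do rewrite rnormC.
(* a g f is the sesquilinear form <T g, f>. *)
pose a g f := cintegral mu Y (fun x => dotp g (F x) * dotp (F x) f).
have ai g f : cintegrable mu Y (fun x => dotp g (F x) * dotp (F x) f).
  by apply: cintegrableM => //; [exact: (sqF g).2|exact: (sqFc f).2].
have a_lin t g1 g2 f : a (t *: g1 + g2) f = t * a g1 f + a g2 f.
  rewrite -cintegral_linear //; congr cintegral; apply/funext => x.
  by rewrite dotpDl dotpZl mulrDl mulrA.
have aC g f : a g f = (a f g)^*.
  rewrite -cintegral_conj //; congr cintegral; apply/funext => x.
  by rewrite rmorphM /= -!dotpC mulrC.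
have a_bnd g f : rnorm (a g f) <= 2 * (B * rnorm g ^+ 2 + B * rnorm f ^+ 2).
  by apply: rnorm_cintegralM_le => //; [exact: (sqF g).2|exact: (sqFc f).2
    |exact: (sqF g).1|exact: (sqFc f).1].
have T_ex g : exists v, forall f, a f g = dotp f v.
  apply: (riesz H_hilbert (M := 2 * (B * 1 ^+ 2 + B * rnorm g ^+ 2))) => // f f1.
  by have := a_bnd f g; rewrite f1.
pose S := [set v | exists g, forall f, dotp v f = a g f].
have [||Scomplete|w w0 wS] := orthogonal_of_not_dense H_hilbert (S := S).
- by have [v av] := T_ex 0; exists v, 0 => f; rewrite aC av -dotpC.
- move=> t x y [g1 h1] [g2 h2]; exists (t *: g2 + g1) => f.
  by rewrite a_lin dotpDl dotpZl h1 h2 addrC.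
- apply: F_ncomplete => U U0 Uo; have [v [Uv [g vg]]] := Scomplete U U0 Uo.
  exists v; split => //; exists (fun x => dotp g (F x)); split; first exact: (sqF g).2.
  by move=> f; split; [exact: ai|exact: vg].
exists w => //.
have [v av] := T_ex w.
have aww : a w w = 0.
  by rewrite av; apply: wS; exists w => f; rewrite aC av -dotpC.
have aE : a w w = (\int[mu]_(x in Y) (rnorm (dotp w (F x)) ^+ 2))%:C%C.
  apply/eqP; rewrite eq_complex /=; apply/andP; split; apply/eqP.
    apply: eq_Rintegral => x _.
    by rewrite sqr_rnorm (dotpC dotp (F x)) ReM ReConj ImConj; ring.
  rewrite /Rintegral integral0_eq // => x _.
  by rewrite (dotpC dotp (F x)) ImM ReConj ImConj; congr EFin; ring.
have [_ wY] := sqF w; have iw := square_integrableP wY.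
have : (\int[mu]_(x in Y) `|(rnorm (dotp w (F x)) ^+ 2)%:E| = 0)%E.
  under eq_integral do rewrite gee0_abs ?lee_fin ?sqr_ge0 //.
  rewrite -(fineK (integrable_fin_num mY iw)); congr EFin.
  by move: aww; rewrite aE => -[].
move/(ae_eq_integral_abs _ mY (measurable_int _ iw)).
apply: filterS => x Fx /Fx /= [] /eqP.
by rewrite sqrf_eq0 => /eqP r0; apply/eqP; rewrite -normr_eq0 -rnormE r0.
Qed.

(** * Perturbation off a large set *)

Lemma integral_tail_lt (Y : (set X)^nat) (u : X -> R) (e : R) :
  \bigcup_n Y n = setT -> {homo Y : n m / (n <= m)%N >-> (n <= m)%O} ->
  (forall n, measurable (Y n)) -> measurable_fun setT u ->
  (forall x, 0 <= u x) -> (\int[mu]_x (u x)%:E < +oo)%E -> 0 < e ->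
  exists n, (\int[mu]_(x in ~` Y n) (u x)%:E < e%:E)%E.
Proof.
move=> YT Y_homo mY mu_u u0 u_fin e0.
have muE : measurable_fun setT (fun x => (u x)%:E) by exact/measurable_EFinP.
have splitY n : (\int[mu]_x (u x)%:E =
    \int[mu]_(x in Y n) (u x)%:E + \int[mu]_(x in ~` Y n) (u x)%:E)%E.
  rewrite -ge0_integral_setU ?setUv //; first exact: measurableC.
    by move=> x _; rewrite lee_fin.
  exact/disj_setPCl.
have I_cvg : (\int[mu]_(x in Y n) (u x)%:E @[n --> \oo] --> \int[mu]_x (u x)%:E)%E.
  rewrite -YT; apply: ge0_nondecreasing_set_cvg_integral => // [n|n x _].
    exact: measurable_funTS.
  by rewrite lee_fin.
have I_fin : (\int[mu]_x (u x)%:E)%E \is a fin_num.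
  by rewrite ge0_fin_numE //; apply: integral_ge0 => x _; rewrite lee_fin.
apply: contrapT => /forallNP tail_ge.
have : (\int[mu]_x (u x)%:E <= \int[mu]_x (u x)%:E - e%:E)%E.
  rewrite -[leLHS](cvg_lim _ I_cvg) //.
  apply: lime_le; first by apply/cvg_ex; eexists; exact: I_cvg.
  apply: nearW => n; rewrite leeBrDr // [leRHS](splitY n) leeD2l //.
  by rewrite leNgt; apply/negP.
by rewrite -(fineK I_fin) -EFinB lee_fin; lra.
Qed.

(** Where f or h is orthogonal to G(x), the numbers <f + h, G(x)> and
    <f - h, G(x)> agree up to sign; but f + h = c (f - h) would make h a
    multiple of f, or f = 0 when c = -1. *)
Lemma not_phase_retrieval_of_complementary (G : X -> H) (f h : H) :
  {ae mu, forall x, dotp f (G x) = 0 \/ dotp h (G x) = 0} ->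
  f != 0 -> (forall t : R[i], h <> t *: f) -> ~ phase_retrieval dotp mu G.
Proof.
move=> fh f0 h_indep pr.
have [|th thE] := pr (f + h) (f - h).
  apply: filterS fh => x [fx|hx]; rewrite !dotpDl -scaleN1r dotpZl.
    by rewrite fx !add0r mulN1r normrN.
  by rewrite hx mulr0 !addr0.
move: (expi th) thE => c fhE.
have hE : h = c *: f - c *: h - f by rewrite -scalerBr -fhE addrAC subrr add0r.
have hf : (1 + c) *: h = (c - 1) *: f.
  by rewrite scalerDl scale1r {1}hE scalerBl scale1r addrAC subrK.
have [c1|c1] := eqVneq (1 + c) 0.
  move/eqP: hf; rewrite c1 scale0r eq_sym scaler_eq0 (negbTE f0) orbF subr_eq0.
  by move=> /eqP cE; move/eqP: c1; rewrite cE (eqr_nat _ 2 0).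
by apply: (h_indep ((1 + c)^-1 * (c - 1))); rewrite -scalerA -hf scalerA mulVf // scale1r.
Qed.

Lemma exists_unit_vector : infinite_dimensional H -> exists f : H, rnorm f = 1.
Proof.
move=> Hinf; have [v v0] : exists v : H, v != 0.
  apply: contrapT => /forallNP H0; apply: Hinf; exists 0%N, (fun=> 0) => v.
  exists (fun=> 0); rewrite big_ord0; apply/eqP.
  by have /negP := H0 v; rewrite negbK.
exists (`|v|^-1 *: v); apply: complexI.
by rewrite rnormE normrZ normfV normr_id mulVf ?normr_eq0.
Qed.

(** On D, for a unit vector f, the orthogonal projection of F(x) along f.  The
    indicator function avoids a case distinction in the proof of weak
    measurability. *)
Definition project_off (D : set X) (f : H) (F : X -> H) (x : X) : H :=
  F x - ((\1_D x : R)%:C%C * dotp (F x) f) *: f.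

Lemma weakly_measurable_project_off (D : set X) (f : H) (F : X -> H) :
  measurable D -> weakly_measurable dotp F ->
  weakly_measurable dotp (project_off D f F).
Proof.
move=> mD mF g.
have conj_real (r : R) : (r%:C%C)^* = r%:C%C by exact: conjc_real.
have -> : (fun x => dotp g (project_off D f F x)) =
    (fun x => dotp g (F x) + (- (\1_D x : R)%:C%C * dotp g f) * dotp f (F x)).
  apply/funext => x; rewrite /project_off dotpDr dotpNr dotpZr rmorphM /= -dotpC.
  by rewrite conj_real; ring.
apply: cmeasurable_funD => //; apply: cmeasurable_funM => //.
apply: cmeasurable_funM; last by split; exact: measurable_cst.
split => /=; last by under eq_fun do rewrite oppr0; exact: measurable_cst.
by apply: measurable_funN; exact: measurable_indic.
Qed.

Lemma dotp_project_off (D : set X) (f : H) (F : X -> H) (x : X) :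
  rnorm f = 1 -> D x -> dotp f (project_off D f F x) = 0.
Proof.
move=> f1 Dx; rewrite /project_off indicE mem_set // mul1r.
by rewrite dotpDr dotpNr dotpZr -dotpC dotp_rnorm // f1 expr1n mulr1 subrr.
Qed.

Lemma project_off_id (D : set X) (f : H) (F : X -> H) (x : X) :
  ~ D x -> project_off D f F x = F x.
Proof. by move=> Dx; rewrite /project_off indicE memNset // mul0r scale0r subr0. Qed.

Lemma integral_project_off (D : set X) (f : H) (F : X -> H) :
  rnorm f = 1 ->
  (\int[mu]_x (rnorm (F x - project_off D f F x) ^+ 2)%:E
  = \int[mu]_(x in D) (rnorm (dotp f (F x)) ^+ 2)%:E)%E.
Proof.
move=> f1; rewrite [RHS]integral_mkcond; apply: eq_integral => x _.
rewrite /project_off opprB addrC subrK rnormZ f1 mulr1 patchE.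
case: ifPn => xD; rewrite indicE ?xD ?(negbTE xD) ?mul1r.
  by rewrite dotpC /rnorm norm_conjC.
by rewrite mul0r /rnorm normr0 expr0n.
Qed.

End Frames.

(** * Instability of phase retrieval *)

Theorem theorem3p8 (R : realType) (H : completeNormedModType R[i])
    (dotp : {dot H for @Num.conj R[i]})
    (H_hilbert : hilbert_norm dotp)
    (H_infinite : infinite_dimensional H)
    (H_separable : separable H)
    (d : measure_display) (X : measurableType d)
    (mu : {measure set X -> \bar R})
    (mu_sigma_finite : sigma_finite setT mu)
    (mu_infinite : mu setT = +oo%E)
    (F : X -> H) (A B : R)
    (F_frame : continuous_frame dotp mu F A B)
    (F_phase_retrieval : phase_retrieval dotp mu F)
    (F_not_complete : forall Y : set X,
      measurable Y -> (mu Y < +oo)%E -> ~ mu_complete dotp mu Y F)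
    (eps : R) (eps_gt0 : 0 < eps) (eps_ltA : eps < A) :
  exists G : X -> H,
    [/\ weakly_measurable dotp G,
        ~ phase_retrieval dotp mu G &
        (\int[mu]_x (rnorm (F x - G x) ^+ 2)%:E < eps%:E)%E].
Proof.
have [A0 B0 mF F_bnd] := F_frame.
have F_le f :
  (\int[mu]_x (rnorm (dotp f (F x)) ^+ 2)%:E <= (B * rnorm f ^+ 2)%:E)%E.
  by case/andP: (F_bnd f).
have mF2 f : measurable_fun setT (fun x => rnorm (dotp f (F x)) ^+ 2).
  exact: cmeasurable_sqr_rnorm.
have [f f1] := exists_unit_vector H_infinite.
have f0 : f != 0 by rewrite -rnorm_gt0 f1.
have [Y0 [YT Y_homo mY]] := (sigma_finiteP _ _).1 mu_sigma_finite.
have [|||||||n tail] := @integral_tail_lt _ _ _ mu Y0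
  (fun x => rnorm (dotp f (F x)) ^+ 2) eps => //.
- by move=> n; case: (mY n).
- by move=> x; rewrite sqr_ge0.
- exact: le_lt_trans (F_le f) (ltry _).
set Y := Y0 n in tail; have [mYn Y_fin] := mY n.
have [h h0 hY] := orthogonal_of_not_mu_complete H_hilbert mYn mF F_le
  (F_not_complete _ mYn Y_fin).
exists (project_off dotp (~` Y) f F); split.
- by apply: weakly_measurable_project_off => //; exact: measurableC.
- apply: (@not_phase_retrieval_of_complementary _ _ _ _ dotp mu _ f h) => //.
    apply: filterS hY => x hx; have [Yx|Yx] := pselect (Y x).
      by right; rewrite project_off_id ?hx // => /(_ Yx).
    by left; rewrite dotp_project_off.
  (* If h = t f, then <f, F> vanishes a.e. on Y, and the lower frame bound at f
     contradicts eps < A. *)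
  move=> t hE; have : (A%:E < eps%:E)%E; last by rewrite lte_fin ltNge ltW.
  apply: le_lt_trans tail.
  have := F_bnd f; rewrite f1 expr1n !mulr1 => /andP[A_le _].
  apply: le_trans A_le _.
  rewrite [leRHS]integral_mkcond; apply: ae_ge0_le_integral => //.
  - by move=> x _; rewrite lee_fin sqr_ge0.
  - exact/measurable_EFinP.
  - by move=> x _; rewrite patchE; case: ifP => // _; rewrite lee_fin sqr_ge0.
  - apply/(measurable_restrictT _ (measurableC mYn)).
    exact/measurable_EFinP/measurable_funTS.
  apply: filterS hY => x hx _; rewrite patchE; case: ifPn => // /negP xY.
  have : dotp h (F x) = 0.
    by apply: hx; apply: contrapT => Yx; apply: xY; rewrite inE.
  rewrite hE dotpZl => /eqP; rewrite mulf_eq0 => /orP[/eqP t0|/eqP ->].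
    by move: h0; rewrite hE t0 scale0r eqxx.
  by rewrite /rnorm normr0 expr0n.
- by rewrite integral_project_off.
Qed.
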